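(* Let $H=(V,S)$ be a signed hypergraph of rank $r$ whose underlying hypergraph is $\alpha$-acyclic. Then $\mathcal P_{pB}(H)$ has an extended formulation with at most $\left(\frac{2}{3}\cdot 3^{r}+2(r-1)(2^r+1)\right)|V|$ variables and inequalities. In particular, if $r=O(\log\mathrm{poly}(|V|,|S|))$, then $\mathcal P_{pB}(H)$ has a polynomial-size extended formulation. Moreover, all coefficients and right-hand side constants in the system defining $\mathcal P_{pB}(H)$ (i.e., in this extended formulation) are $0,\pm 1$.
   Context: A hypergraph is a pair $(V,E)$ with $V$ a finite set of nodes and $E$ a set of edges, which are subsets of $V$ of cardinality at least two. A signed hypergraph $H$ is a pair $(V,S)$ with $V$ a finite set of nodes and $S$ a set of signed edges. A signed edge is a pair $s=(e,\eta_s)$ with $e\subseteq V$, $|e|\ge 2$, and $\eta_s:e\to\{-1,+1\}$; $e$ is its underlying edge. No two signed edges of $S$ are identical (same $e$ and same $\eta_s$), but signed edges may be parallel (same $e$). Set-theoretic notation for $s$ refers to its underlying edge. The underlying hypergraph of $H$ is obtained by ignoring signs and dropping parallel edges. The rank of a (signed) hypergraph is the maximum cardinality of any of its (signed) edges. For a hypergraph $G=(V,E)$ and $v\in V$, $G-v$ is the hypergraph with node set $V\setminus\{v\}$ and edge set $\{e\setminus\{v\}: e\in E,\ |e\setminus\{v\}|\ge 1\}$. A node $v$ is an $\alpha$-leaf of $G$ if the set of edges of $G$ containing $v$ has a maximal element for inclusion, that is, an edge that contains all the edges of $G$ containing $v$ (this holds vacuously if no edge contains $v$). $G$ is $\alpha$-acyclic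 if there is an ordering $v_1,\dots,v_n$ of all its nodes ($n=|V|$) such that $v_1$ is an $\alpha$-leaf of $G$, $v_2$ is an $\alpha$-leaf of $G-v_1$, and so on, until $v_n$ is an $\alpha$-leaf of $G-v_1-\cdots-v_{n-1}$. For a signed edge $s$ and $v\in s$, let $\sigma_s(z_v):=z_v$ if $\eta_s(v)=+1$ and $\sigma_s(z_v):=1-z_v$ if $\eta_s(v)=-1$. The pseudo-Boolean set is $\mathcal S_{pB}(H):=\{z\in\{0,1\}^{V\cup S}: z_s=\prod_{v\in s}\sigma_s(z_v)\ \forall s\in S\}$, and the pseudo-Boolean polytope $\mathcal P_{pB}(H)$ is its convex hull. An extended formulation of $\mathcal P_{pB}(H)$ is a finite system of linear inequalities and equalities in variables $(z,y)$, with $z$ indexed by $V\cup S$ and $y$ a vector of additional variables, whose solution set projects onto $\mathcal P_{pB}(H)$ in the $z$-space. It is polynomial-size if its number of variables and constraints is bounded by a polynomial in $|V|,|S|$. $\mathrm{poly}(|V|,|S|)$ denotes a polynomial function of $|V|,|S|$; the asymptotic statement is understood over a family of instances with a fixed polynomial and fixed $O$-constant, the resulting polynomial size bound being uniform over the family. *)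

(* Defs.v *)
From HB Require Import structures.
From mathcomp Require Import all_boot all_order all_algebra.
From mathcomp Require Import boolp classical_sets reals exp convex.

Set Implicit Arguments.
Unset Strict Implicit.
Unset Printing Implicit Defensive.

Import Order.TTheory GRing.Theory Num.Theory.

Local Open Scope ring_scope.

(* The node set is an explicit subset of an ambient finite type, so that
   deleting a node stays within the same type.  No lower bound on the
   cardinality of edges is built in: deleting nodes may create singletons. *)
Record hypergraph (V : finType) := Hypergraph {
  hnodes : {set V};
  hedges : {set {set V}};
}.

Definition delete_node (V : finType) (G : hypergraph V) (v : V) :
    hypergraph V :=
  {| hnodes := hnodes G :\ v;
     hedges := [set f in [set e :\ v | e in hedges G] | (1 <= #|f|)%N] |}.

Definition alpha_leaf (V : finType) (G : hypergraph V) (v : V) : Prop :=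
  (forall e, e \in hedges G -> v \notin e) \/
  (exists f, [/\ f \in hedges G, v \in f
              & forall e, e \in hedges G -> v \in e -> e \subset f]).

Fixpoint alpha_elimination (V : finType) (G : hypergraph V) (s : seq V) :
    Prop :=
  match s with
  | [::] => True
  | v :: s' => alpha_leaf G v /\ alpha_elimination (delete_node G v) s'
  end.

Definition alpha_acyclic (V : finType) (G : hypergraph V) : Prop :=
  exists s : seq V, [/\ uniq s, s =i hnodes G & alpha_elimination G s].

(* A pair (e, eta) with eta : e -> {-1, +1}; the sign +1 is [true]. *)
Definition signed_edge (V : finType) : finType :=
  {e : {set V} & {ffun {v : V | v \in e} -> bool}}.

Definition underlying_edge (V : finType) (s : signed_edge V) : {set V} :=
  tag s.

(* The node set is the whole type V. *)
Record signed_hypergraph (V : finType) := SignedHypergraph {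
  sedges : {set signed_edge V};
  sedges_card : forall s, s \in sedges -> (2 <= #|underlying_edge s|)%N;
}.

Definition underlying_hypergraph (V : finType) (H : signed_hypergraph V) :
    hypergraph V :=
  {| hnodes := [set: V];
     hedges := [set underlying_edge s | s in sedges H] |}.

(* The maximum is required to be attained, so a signed hypergraph without
   signed edges has no rank. *)
Definition has_rank (V : finType) (H : signed_hypergraph V) (r : nat) : Prop :=
  (exists2 s, s \in sedges H & #|underlying_edge s| = r) /\
  (forall s, s \in sedges H -> (#|underlying_edge s| <= r)%N).

(* The index set "V union S" of the variables z. *)
Definition zvar (V : finType) (H : signed_hypergraph V) : finType :=
  (V + {s : signed_edge V | s \in sedges H})%type.

(* R^o is R viewed as a module over itself; it makes the space of z-vectors
   an R-module. *)
Definition zpoint (R : realType) (V : finType) (H : signed_hypergraph V) :=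
  {ffun zvar H -> R^o}.

Definition edge_prod (R : realType) (V : finType) (s : signed_edge V)
    (z : V -> R) : R :=
  \prod_(u : {v : V | v \in tag s})
    (if tagged s u then z (val u) else 1 - z (val u)).

Definition pB_set (R : realType) (V : finType) (H : signed_hypergraph V) :
    set (zpoint R H) :=
  fun z =>
    (forall j : zvar H, z j = 0 \/ z j = 1) /\
    (forall s : {s : signed_edge V | s \in sedges H},
       z (inr s) = edge_prod (val s) (fun v => z (inl v))).

Definition convex_hull (R : realType) (E : lmodType R) (A : set E) : set E :=
  smallest (@convex_set R E) A.

Definition pB_polytope (R : realType) (V : finType)
    (H : signed_hypergraph V) : set (zpoint R H) :=
  convex_hull (pB_set (R := R) (H := H)).

(* The system  A x <= b, C x = d  in the variables indexed by J. *)
Record lin_system (R : realType) (J : finType) := LinSystem {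
  num_ineq : nat;
  ineq_coef : 'I_num_ineq -> J -> R;
  ineq_rhs : 'I_num_ineq -> R;
  num_eq : nat;
  eq_coef : 'I_num_eq -> J -> R;
  eq_rhs : 'I_num_eq -> R;
}.

Definition solution (R : realType) (J : finType) (L : lin_system R J)
    (x : J -> R) : Prop :=
  (forall i, \sum_(j : J) ineq_coef (l := L) i j * x j <= ineq_rhs i) /\
  (forall i, \sum_(j : J) eq_coef (l := L) i j * x j = eq_rhs i).

Definition num_var (R : realType) (J : finType) (L : lin_system R J) : nat :=
  #|J|.

Definition num_constr (R : realType) (J : finType) (L : lin_system R J) :
    nat :=
  (num_ineq L + num_eq L)%N.

Definition join_point (J K : finType) (R : Type) (z : J -> R) (y : K -> R)
    (j : J + K) : R :=
  match j with inl a => z a | inr b => y b end.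

Definition extended_formulation (R : realType) (V : finType)
    (H : signed_hypergraph V) (k : nat)
    (L : lin_system R (zvar H + 'I_k)%type) : Prop :=
  forall z : zpoint R H,
    pB_polytope z <->
    exists y : 'I_k -> R, solution L (join_point z y).

Definition in_0pm1 (R : realType) (a : R) : Prop :=
  [\/ a = 0, a = 1 | a = -1].

Definition all_data_0pm1 (R : realType) (J : finType) (L : lin_system R J) :
    Prop :=
  [/\ forall i j, in_0pm1 (ineq_coef (l := L) i j),
      forall i, in_0pm1 (ineq_rhs (l := L) i),
      forall i j, in_0pm1 (eq_coef (l := L) i j)
    & forall i, in_0pm1 (eq_rhs (l := L) i)].

Definition size_bound (R : realType) (r n : nat) : R :=
  (2 / 3 * 3 ^+ r + 2 * (r%:R - 1) * (2 ^+ r + 1)) * n%:R.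

(* Main.v *)
From mathcomp Require Import interval_inference ring lra zify.
Require Import Defs.
From HB Require Import structures.
From mathcomp Require Import all_boot all_order all_algebra.
From mathcomp Require Import boolp classical_sets reals exp convex.
From mathcomp Require Import unstable sequences fintype finset.

Set Implicit Arguments.
Unset Strict Implicit.
Unset Printing Implicit Defensive.

Import Order.TTheory GRing.Theory Num.Theory.

Local Open Scope ring_scope.

(** An alpha-elimination ordering of the nodes provides a tree decomposition
    of the hypergraph into bags of at most r nodes: the bag of v is the largest
    edge containing v in the hypergraph that remains when v is eliminated (or
    [set v] if there is none).  What remains of a bag once its own node is
    eliminated is empty or contained in a later bag, called its parent, and each
    edge lies in the bag of its first eliminated node ([perfect_elimination_ex]).

    The extended formulation has one variable [lam v T] for each bag [F v] and
    each subset T of it, to be read as the probability that, within the bag, the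
    nodes with value 1 are exactly those of T.  The constraints say that each
    [lam v] is a probability distribution, that it has the same marginal as the
    distribution of its parent bag on their common part [F v :\ v], and that
    each variable z_j, a node or a signed edge, is the probability that j is
    satisfied, computed in a bag that contains j ([local_systemP]).

    A 0/1 point of the pseudo-Boolean set clearly gives a solution, and
    solutions form a convex set.  Conversely, two distributions with equal
    marginals on the nodes common to both can be glued, by making them
    conditionally independent given that part ([amalgamation]).  Adding the bags
    one at a time from the last eliminated node to the first, one obtains a
    single distribution on all subsets of V whose marginals on the bags are the
    [lam v] ([joint_distribution]); z is then the average of the 0/1 points
    under this distribution, hence is in the convex hull ([hull_local_model]).

    For the size, write n for the number of nodes.  There are at most
    [n * 2 ^ r] variables [lam v T], as many inequalities, and at most
    [n * (1 + 2 ^ r.-1)] equations besides those that define z.  A signed edge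
    whose first eliminated node is v labels each node of [F v] positive,
    negative or absent, and v itself is not absent, so there are at most
    [n * (2 * 3 ^ r.-1)] signed edges ([card_sedges]); this is the term
    2/3 * 3^r of the bound.  If r is at most C ln P, then 4^r is at most a fixed
    power of P, and the bound becomes polynomial ([exp_le_poly]). *)

(** * Marginals and gluing of distributions on subsets *)

Section Marginals.
Variables (R : realFieldType) (V : finType).
Implicit Types (mu nu lam : {set V} -> R) (A B T U : {set V}).

(** A 0/1 assignment of the nodes is encoded as the set of nodes of value 1, so
    its restriction to A is the intersection with A. *)
Definition marginal A mu T : R := \sum_(U | U :&: A == T) mu U.

(** Change of variables: the marginal is the image of [mu] under restriction. *)
Lemma sum_marginal A mu (g : {set V} -> R) :
  \sum_T marginal A mu T * g T = \sum_U mu U * g (U :&: A).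
Proof.
rewrite [RHS](partition_big (fun U => U :&: A) xpredT) //=.
apply: eq_bigr => T _; rewrite /marginal mulr_suml.
by apply: eq_bigr => U /eqP ->.
Qed.

Lemma marginalE A mu T : marginal A mu T = \sum_U mu U * (U :&: A == T)%:R.
Proof.
by rewrite /marginal big_mkcond; apply: eq_bigr => U _; case: ifP => _;
  rewrite ?mulr1 ?mulr0.
Qed.

Lemma marginal_marginal A B mu : A \subset B ->
  marginal A (marginal B mu) =1 marginal A mu.
Proof.
move=> sAB T; rewrite [RHS]marginalE marginalE.
rewrite (sum_marginal B mu (fun U => (U :&: A == T)%:R)).
by apply: eq_bigr => U _; rewrite -setIA (setIidPr sAB).
Qed.

Lemma marginal_id A mu : (forall U, ~~ (U \subset A) -> mu U = 0) ->
  marginal A mu =1 mu.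
Proof.
move=> supp T; rewrite marginalE (bigD1 T) //= big1 ?addr0.
  have [sTA|/supp ->] := boolP (T \subset A); last by rewrite mul0r.
  by rewrite (setIidPl sTA) eqxx mulr1.
move=> U neUT; have [sUA|/supp ->] := boolP (U \subset A); last by rewrite mul0r.
by rewrite (setIidPl sUA) (negPf neUT) mulr0.
Qed.

Lemma eq_marginal A mu nu : mu =1 nu -> marginal A mu =1 marginal A nu.
Proof. by move=> e T; apply: eq_bigr => U _. Qed.

Lemma marginal_eq0 A mu : (forall U, 0 <= mu U) ->
  forall U, marginal A mu (U :&: A) = 0 -> mu U = 0.
Proof.
move=> mu0 U m0; have := @psumr_eq0P _ _ (fun W => W :&: A == U :&: A) mu.
by apply=> // W _; apply: mu0.
Qed.

Lemma sum_marginal_total A mu : \sum_T marginal A mu T = \sum_U mu U.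
Proof.
have := sum_marginal A mu (fun=> 1).
by under eq_bigr do rewrite mulr1; under [RHS]eq_bigr do rewrite mulr1.
Qed.

(** Conditionally on the common part [A :&: B], the restriction to A follows [mu]
    and the restriction to B follows [lam], independently.  Where the common
    marginal vanishes the division yields 0, which is harmless because [mu]
    vanishes there as well. *)
Definition amalgam A B mu lam (W : {set V}) : R :=
  \sum_U \sum_(T | T :&: (A :&: B) == U :&: (A :&: B))
    ((U :&: A) :|: (T :&: B) == W)%:R
      * (mu U * lam T / marginal (A :&: B) mu (U :&: (A :&: B))).

Lemma amalgam_ge0 A B mu lam : (forall U, 0 <= mu U) -> (forall U, 0 <= lam U) ->
  forall W, 0 <= amalgam A B mu lam W.
Proof.
move=> mu0 lam0 W; apply: sumr_ge0 => U _; apply: sumr_ge0 => T _.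
by rewrite mulr_ge0 ?divr_ge0 ?mulr_ge0 ?sumr_ge0.
Qed.

(** Symmetry reduces the marginal on B to the marginal on A. *)
Lemma amalgamC A B mu lam :
  marginal (A :&: B) mu =1 marginal (A :&: B) lam ->
  amalgam A B mu lam =1 amalgam B A lam mu.
Proof.
move=> agree W; rewrite /amalgam.
rewrite (exchange_big_dep xpredT) //=; apply: eq_bigr => T _.
rewrite [B :&: A]setIC; apply: eq_big => [U|U /eqP e]; first by rewrite eq_sym.
by rewrite setUC e agree [lam T * _]mulrC.
Qed.

Lemma marginal_amalgam A B mu lam : (forall U, 0 <= mu U) ->
  marginal (A :&: B) mu =1 marginal (A :&: B) lam ->
  marginal A (amalgam A B mu lam) =1 marginal A mu.
Proof.
move=> mu0 agree W; rewrite marginalE [RHS]marginalE.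
under eq_bigr => X _ do rewrite /amalgam mulr_suml.
rewrite exchange_big /=; apply: eq_bigr => U _.
under eq_bigr => X _ do rewrite /amalgam mulr_suml.
rewrite exchange_big /=.
transitivity (\sum_(T | T :&: (A :&: B) == U :&: (A :&: B))
   lam T * (mu U / marginal (A :&: B) mu (U :&: (A :&: B)) * (U :&: A == W)%:R)).
  apply: eq_bigr => T /eqP eT.
  rewrite (bigD1 ((U :&: A) :|: (T :&: B))) //= big1 ?addr0; last first.
    by move=> X /negPf; rewrite eq_sym => ->; rewrite !mul0r.
  (* The glued set restricts to U on A because U and T agree on A :&: B. *)
  have -> : (U :&: A :|: T :&: B) :&: A = U :&: A.
    rewrite setIUl -setIA setIid -setIA [B :&: A]setIC eT.
    by apply/setUidPl; rewrite setIA subsetIl.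
  by rewrite eqxx mul1r [mu U * _]mulrC -!mulrA.
rewrite -mulr_suml -/(marginal _ _ _) -agree mulrA; congr (_ * _).
have [m0|mn0] := eqVneq (marginal (A :&: B) mu (U :&: (A :&: B))) 0.
  by rewrite m0 mul0r (marginal_eq0 mu0 m0).
by rewrite mulrC divfK.
Qed.

Lemma amalgamation A B mu lam :
    (forall U, 0 <= mu U) -> (forall U, 0 <= lam U) ->
    marginal (A :&: B) mu =1 marginal (A :&: B) lam ->
  exists nu, [/\ forall U, 0 <= nu U, marginal A nu =1 marginal A mu
               & marginal B nu =1 marginal B lam].
Proof.
move=> mu0 lam0 agree; exists (amalgam A B mu lam).
split; [exact: amalgam_ge0|exact: marginal_amalgam|] => T.
rewrite (eq_marginal B (amalgamC agree)) marginal_amalgam // => X.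
by rewrite setIC agree.
Qed.

End Marginals.

(** * Finite convex combinations *)

(** Induction on the number of points requires partial sums of weights, which
    need not be 1 and may be 0; the partial combinations are therefore
    renormalised, the case of zero total weight being kept apart. *)
Lemma convex_set_sum (R : realType) (E : lmodType R) (A : set E)
    (I : Type) (r : seq I) (w : I -> R) (x : I -> E) :
    @convex_set R E A -> (forall i, 0 <= w i) -> (forall i, A (x i)) ->
    \sum_(i <- r) w i = 1 -> A (\sum_(i <- r) w i *: x i).
Proof.
move=> convA w0 Ax sum1.
suff [[s0 _]|[_]] : (\sum_(i <- r) w i = 0 /\ \sum_(i <- r) w i *: x i = 0) \/
    (0 < \sum_(i <- r) w i /\
     A ((\sum_(i <- r) w i)^-1 *: (\sum_(i <- r) w i *: x i))).
- by move: s0 => /eqP; rewrite sum1 oner_eq0.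
- by rewrite sum1 invr1 scale1r.
elim: r {sum1} => [|i r IH]; first by left; rewrite !big_nil.
rewrite !big_cons; have [wi0|wi_neq0] := eqVneq (w i) 0.
  by rewrite wi0 scale0r !add0r.
have wi_gt0 : 0 < w i by rewrite lt_def wi_neq0 w0.
right; case: IH => [[-> ->]|[t_gt0 At]].
  by rewrite !addr0 scalerA mulVf // scale1r.
set t := \sum_(j <- r) w j in t_gt0 At *; split; first exact: addr_gt0.
have wt_neq0 : w i + t != 0 by rewrite gt_eqF // addr_gt0.
have p0 : 0 <= w i / (w i + t) by rewrite divr_ge0 // addr_ge0 // ltW.
have p1 : w i / (w i + t) <= 1.
  by rewrite ler_pdivrMr ?addr_gt0 // mul1r lerDl ltW.
have := convA (x i) _ (Itv01 p0 p1) (mem_set (Ax i)) (mem_set At).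
move/set_mem; congr A.
rewrite /conv /= scalerDr !scalerA [_^-1 * w i]mulrC; congr (_ + _ *: _).
rewrite /onem -[X in X - _](divff wt_neq0) -mulrBl [w i + t]addrC addrK.
by rewrite mulrAC divff ?mul1r // gt_eqF.
Qed.

(** * Bags from an alpha-elimination ordering *)

Section Elimination.
Variable V : finType.
Implicit Types (F : V -> {set V}) (par : V -> V).

(** The parent bag is only constrained when something remains of the bag of v;
    the last bag of a connected component has no later bag to be attached to. *)
Fixpoint perfect_elimination F par (s : seq V) : Prop :=
  match s with
  | [::] => True
  | v :: s' =>
      [/\ v \in F v, F v \subset v |: [set u in s'],
          F v :\ v = set0 \/ (par v \in s' /\ F v :\ v \subset F (par v))
        & perfect_elimination F par s']
  end.

Lemma eq_perfect_elimination F F' par par' s : {in s, F =1 F'} ->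
  {in s, par =1 par'} ->
  perfect_elimination F par s -> perfect_elimination F' par' s.
Proof.
elim: s => //= v s IH eF epar [vF Fs Fpar ps].
have memv : v \in v :: s by rewrite mem_head.
have vs u : u \in s -> u \in v :: s by rewrite inE => ->; rewrite orbT.
rewrite -eF // -epar //; split => //.
  case: Fpar => [|[ws Fw]]; [by left|right].
  by rewrite -eF // vs.
by apply: IH ps => u /vs /[dup] us; [rewrite eF|rewrite epar].
Qed.

Lemma perfect_elimination_mem F par s v : perfect_elimination F par s ->
  v \in s -> v \in F v.
Proof.
by elim: s => //= u s IH [uF _ _ ps]; rewrite inE => /orP[/eqP ->|/(IH ps)].
Qed.

Lemma perfect_elimination_par F par s v : perfect_elimination F par s ->
  v \in s -> F v :\ v \subset F (par v).
Proof.
elim: s => //= u s IH [_ _ Fu ps]; rewrite inE => /orP[/eqP ->|/(IH ps) //].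
by case: Fu => [->|[]//]; rewrite sub0set.
Qed.

(** The bag of the first node v is the edge witnessing that v is an alpha-leaf.
    Deleting v turns this edge into an edge of the remaining hypergraph, which
    the induction hypothesis places in some bag: this is the parent.  An edge
    avoiding v survives the deletion unchanged, and any other lies in the bag
    of v. *)
Lemma perfect_elimination_ex r (G : hypergraph V) (s : seq V) :
    (0 < r)%N -> uniq s ->
    (forall e, e \in hedges G -> e \subset [set u in s]) ->
    (forall e, e \in hedges G -> (#|e| <= r)%N) ->
    alpha_elimination G s ->
  exists F, exists par, [/\ perfect_elimination F par s,
    forall v, v \in s -> (#|F v| <= r)%N
    & forall e, e \in hedges G -> e != set0 ->
        exists v, [/\ v \in s, v \in e & e \subset F v]].
Proof.
move=> r0; elim: s G => [|v s IH] G /=.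
  move=> _ Gs _ _; exists (fun=> set0), id; split=> // e /Gs /subsetP es0.
  by case/set0Pn => u /es0; rewrite inE.
case/andP=> vNs us Gs Gr [leafv elim_s].
have v_or_s u : u \in [set u in v :: s] = (u == v) || (u \in s) by rewrite !inE.
have del_s e : e \in hedges (delete_node G v) -> e \subset [set u in s].
  rewrite inE => /andP[/imsetP[f fG ->] _]; apply/subsetP=> u.
  rewrite !inE => /andP[uv /(subsetP (Gs _ fG))].
  by rewrite v_or_s (negPf uv).
have del_r e : e \in hedges (delete_node G v) -> (#|e| <= r)%N.
  rewrite inE => /andP[/imsetP[f fG ->] _]; apply: leq_trans (Gr _ fG).
  by rewrite subset_leq_card // subD1set.
have [F [par [perf Fr cover]]] := IH _ us del_s del_r elim_s.
have [f [fG vf fmax]] : exists f, [/\ f = [set v] \/ f \in hedges G, v \in f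
    & forall e, e \in hedges G -> v \in e -> e \subset f].
  case: leafv => [noe|[f [fG vf fmax]]]; last by exists f; split=> //; right.
  exists [set v]; split; [by left|by rewrite set11|].
  by move=> e /noe /negPf ->.
have fs : f \subset v |: [set u in s].
  case: fG => [->|/Gs]; first by rewrite sub1set setU11.
  by move/subset_trans; apply; apply/subsetP=> u; rewrite !inE.
have [w Fw] : exists w, f :\ v = set0 \/ (w \in s /\ f :\ v \subset F w).
  have [->|fv0] := eqVneq (f :\ v) set0; first by exists v; left.
  case: fG => [fE|fG]; first by rewrite fE setDv eqxx in fv0.
  have [|//|w [ws _ fw]] := cover (f :\ v); last by exists w; right.
  by rewrite inE card_gt0 fv0 andbT; apply/imsetP; exists f.
have eqF : {in s, F =1 fun u => if u == v then f else F u}.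
  by move=> u us'; case: eqP us' => // ->; rewrite (negPf vNs).
have eqpar : {in s, par =1 fun u => if u == v then w else par u}.
  by move=> u us'; case: eqP us' => // ->; rewrite (negPf vNs).
exists (fun u => if u == v then f else F u),
  (fun u => if u == v then w else par u).
rewrite eqxx; split.
- split=> //; last exact: eq_perfect_elimination perf.
  by case: Fw => [|[ws fw]]; [left|right; rewrite -eqF].
- move=> u; rewrite inE; case: eqP => [_ _|_ /Fr //].
  by case: fG => [->|/Gr //]; rewrite cards1.
move=> e eG e0; have [ve|vNe] := boolP (v \in e).
  by exists v; rewrite mem_head eqxx; split=> //; apply: fmax.
have [|//|u [us' ue eF]] := cover e.
  rewrite inE card_gt0 e0 andbT; apply/imsetP; exists e => //.
  apply/setP=> u; rewrite !inE; have [->|] //= := eqVneq u v.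
  by rewrite (negPf vNe).
by exists u; rewrite inE us' orbT -eqF.
Qed.

End Elimination.

(** * From compatible local distributions to the convex hull *)

Section LocalModels.
Variables (R : realType) (V : finType).
Variables (F : V -> {set V}) (par : V -> V).
Implicit Types (lam : V -> {set V} -> R) (mu : {set V} -> R).

Record local_model lam : Prop := LocalModel {
  lm_ge0 : forall v T, 0 <= lam v T;
  lm_supp : forall v (T : {set V}), ~~ (T \subset F v) -> lam v T = 0;
  lm_total : forall v, \sum_T lam v T = 1;
  lm_agree : forall v,
    marginal (F v :\ v) (lam v) =1 marginal (F v :\ v) (lam (par v)) }.

Lemma marginal_set0 mu T : marginal set0 mu T = (T == set0)%:R * \sum_U mu U.
Proof.
rewrite marginalE mulr_sumr; apply: eq_bigr => U _.
by rewrite setI0 mulrC eq_sym.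
Qed.

Lemma perfect_elimination_sub s v : perfect_elimination F par s -> v \in s ->
  F v \subset [set u in s].
Proof.
elim: s => //= w s IH [_ Fw _ ps]; rewrite inE => /orP[/eqP ->|vs].
  by apply: subset_trans Fw _; apply/subsetP=> u; rewrite !inE.
apply: subset_trans (IH ps vs) _; apply/subsetP=> u; rewrite !inE => ->.
by rewrite orbT.
Qed.

(** The bags are added from the last node to the first.  When v is added, the
    current distribution is known on the later nodes A, and [A :&: F v] is
    [F v :\ v], which is empty or lies in the parent bag; so the agreement required by the
    gluing lemma is exactly the agreement of [lam v] with its parent. *)
Lemma joint_distribution s lam : uniq s -> perfect_elimination F par s ->
    local_model lam ->
  exists mu, [/\ forall U, 0 <= mu U, \sum_U mu U = 1
               & {in s, forall v, marginal (F v) mu =1 lam v}].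
Proof.
move=> us ps [lam0 supp total agree]; elim: s us ps => [|v s IH] /=.
  exists (fun U => (U == set0)%:R); split=> //.
  by rewrite (bigD1 set0) //= eqxx big1 ?addr0 // => U /negPf ->.
case/andP=> vNs us [vF Fs Fpar ps]; have [mu [mu0 mu1 muF]] := IH us ps.
set A := [set u in s] in Fs *.
have AF : A :&: F v = F v :\ v.
  apply/setP=> u; rewrite !inE; have [->|uv] /= := eqVneq u v.
    by rewrite (negPf vNs).
  have [uF|_] := boolP (u \in F v); last by rewrite andbF.
  by have := subsetP Fs _ uF; rewrite !inE (negPf uv) /= => ->.
have agreeA : marginal (A :&: F v) mu =1 marginal (A :&: F v) (lam v).
  rewrite AF => T; case: Fpar => [->|[ws Fw]].
    (* With no common node, agreement means equality of the total masses. *)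
    by rewrite !marginal_set0 mu1 total.
  by rewrite agree -(marginal_marginal _ Fw) (eq_marginal _ (muF _ ws)).
have [nu [nu0 nuA nuF]] := amalgamation mu0 (lam0 v) agreeA.
exists nu; split=> //.
  rewrite -mu1 -(sum_marginal_total A) -[RHS](sum_marginal_total A).
  by apply: eq_bigr.
move=> u; rewrite inE => /orP[/eqP ->|us'] T.
  by rewrite nuF marginal_id //; apply: supp.
have FA : F u \subset A by apply: perfect_elimination_sub ps us'.
by rewrite -(marginal_marginal _ FA) (eq_marginal _ nuA) marginal_marginal // muF.
Qed.

Lemma local_model_of_set U : (forall v, F v :\ v \subset F (par v)) ->
  local_model (fun v T => (T == U :&: F v)%:R).
Proof.
move=> Fpar; have marg (A B : {set V}) : A \subset B ->
    marginal A (fun T => (T == U :&: B)%:R : R) =1 fun T => (U :&: A == T)%:R.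
  move=> sAB T; rewrite marginalE (bigD1 (U :&: B)) //= eqxx mul1r big1 ?addr0.
    by rewrite -setIA (setIidPr sAB).
  by move=> W /negPf ->; rewrite mul0r.
split=> [v T|v T|v|v T]; first by rewrite ler0n.
- by have [->|//] := eqVneq T (U :&: F v); rewrite subsetIr.
- by rewrite (bigD1 (U :&: F v)) //= eqxx big1 ?addr0 // => T /negPf ->.
- by rewrite !marg // subD1set.
Qed.

Lemma local_model_conv (p : {i01 R}) lam1 lam2 :
  local_model lam1 -> local_model lam2 ->
  local_model (fun v T => p%:num * lam1 v T + (1 - p%:num) * lam2 v T).
Proof.
have marg A (f g : {set V} -> R) T :
    marginal A (fun T => p%:num * f T + (1 - p%:num) * g T) T =
    p%:num * marginal A f T + (1 - p%:num) * marginal A g T.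
  by rewrite /marginal big_split -!mulr_sumr.
case=> p1 s1 t1 a1 [p2 s2 t2 a2]; split=> [v T|v T Tv|v|v T].
- by rewrite addr_ge0 ?mulr_ge0 ?subr_ge0.
- by rewrite s1 ?s2 // !mulr0 addr0.
- by rewrite big_split -!mulr_sumr /= t1 t2 !mulr1 addrC addrNK.
- by rewrite !marg a1 a2.
Qed.

(* A coordinate j is an event on subsets of V that only depends on the bag of
   [home j]: a node or a signed edge in the application. *)
Variables (J : finType) (home : J -> V) (sat : J -> {set V} -> bool).

Definition vertex (U : {set V}) : {ffun J -> R^o} := [ffun j => (sat j U)%:R].

Definition read_off lam (j : J) : R := \sum_T lam (home j) T * (sat j T)%:R.

Hypothesis sat_home : forall j U, sat j (U :&: F (home j)) = sat j U.

(** The local models project onto the convex hull of the 0/1 points: a subset U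
    restricts to a local model, and a local model is the family of marginals of
    a distribution on subsets. *)
Lemma hull_local_model (s : seq V) (z : {ffun J -> R^o}) :
    uniq s -> (forall v, v \in s) -> perfect_elimination F par s ->
    (forall v, F v :\ v \subset F (par v)) ->
  @convex_hull R _ (fun x => exists U, x = vertex U) z <->
  exists2 lam, local_model lam & forall j, z j = read_off lam j.
Proof.
move=> us sV ps Fpar; split; last first.
  case=> lam lamP zE; have [mu [mu0 mu1 muF]] := joint_distribution us ps lamP.
  suff -> : z = \sum_U mu U *: vertex U.
    move=> A [/= convA subA].
    by apply: convex_set_sum => // U; apply: subA; exists U.
  apply/ffunP=> j; rewrite zE sum_ffunE /read_off.
  under eq_bigr do rewrite -muF //.
  rewrite sum_marginal; apply: eq_bigr => U _.
  by rewrite !ffunE sat_home.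
move=> hull_z.
apply: (hull_z (fun x =>
  exists2 lam, local_model lam & forall j, x j = read_off lam j)); split.
- move=> x y p /set_mem[lam1 m1 xE] /set_mem[lam2 m2 yE]; apply/mem_set.
  exists (fun v T => p%:num * lam1 v T + (1 - p%:num) * lam2 v T).
    exact: local_model_conv.
  move=> j; transitivity (p%:num * read_off lam1 j
                          + (1 - p%:num) * read_off lam2 j).
    by rewrite -xE -yE !ffunE.
  rewrite /read_off !mulr_sumr -big_split.
  by apply: eq_bigr => T _ /=; ring.
- move=> x [U ->]; exists (fun v T => (T == U :&: F v)%:R).
    exact: local_model_of_set.
  move=> j; rewrite ffunE /read_off (bigD1 (U :&: F (home j))) //= eqxx.
  rewrite sat_home mul1r big1 ?addr0 // => T /negPf ->.
  by rewrite mul0r.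
Qed.

End LocalModels.

(** * The linear system *)

Section FiniteSystem.
Variables (R : realType) (J K I E : finType).
Variables (a : I -> J + K -> R) (b : I -> R) (c : E -> J + K -> R) (d : E -> R).

(** Rows and auxiliary variables indexed by arbitrary finite types are renumbered
   by ordinals. *)
Definition index_var (x : J + 'I_#|K|) : J + K :=
  match x with inl j => inl j | inr k => inr (enum_val k) end.

Definition fin_system : lin_system R (J + 'I_#|K|)%type :=
  @LinSystem R _ #|I| (fun i x => a (enum_val i) (index_var x))
    (fun i => b (enum_val i))
    #|E| (fun e x => c (enum_val e) (index_var x)) (fun e => d (enum_val e)).

Lemma fin_systemP (z : J -> R) :
  (exists y : 'I_#|K| -> R, solution fin_system (join_point z y)) <->
  exists y : K -> R,
    (forall i, \sum_x a i x * join_point z y x <= b i) /\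
    (forall e, \sum_x c e x * join_point z y x = d e).
Proof.
have sumE (f : J + K -> R) (y : K -> R) :
    \sum_x f (index_var x) * join_point z (fun k => y (enum_val k)) x =
    \sum_x f x * join_point z y x.
  rewrite !big_sumType /=; congr (_ + _).
  by rewrite [RHS](reindex _ (onW_bij _ (@enum_val_bij K))).
split=> [[y [Ha Hc]]|[y [Ha Hc]]].
  exists (fun k => y (enum_rank k)).
  have yE (f : J + K -> R) :
      \sum_x f (index_var x) * join_point z y x =
      \sum_x f x * join_point z (fun k => y (enum_rank k)) x.
    rewrite -sumE; apply: eq_bigr => -[j|k] _ //=.
    by rewrite enum_valK.
  split=> [i|e]; rewrite -yE.
    by have := Ha (enum_rank i); rewrite /= enum_rankK.
  by have := Hc (enum_rank e); rewrite /= enum_rankK.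
exists (fun k => y (enum_val k)); split=> [i|e] /=; rewrite sumE //.
Qed.

End FiniteSystem.

Section LocalSystem.
Variables (R : realType) (V : finType).
Variables (F : V -> {set V}) (par : V -> V).
Variables (J : finType) (home : J -> V) (sat : J -> {set V} -> bool).

Definition bag_pred : {pred V * {set V}} :=
  [pred x : V * {set V} | x.2 \subset F x.1].
Definition sep_pred : {pred V * {set V}} :=
  [pred x : V * {set V} | x.2 \subset F x.1 :\ x.1].
Notation bag := {x | x \in bag_pred}.
Notation sep := {x | x \in sep_pred}.

Definition ineq_row (k : bag) (x : J + bag) : R :=
  match x with inl _ => 0 | inr k' => - (k' == k)%:R end.

Definition pick_bag (v : V) (P : {set V} -> bool) (k : bag) : bool :=
  ((val k).1 == v) && P (val k).2.

(** Three families of equations: total mass of each bag, agreement of a bag with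
    its parent on each subset of their common part, definition of each z_j. *)
Definition eq_row (e : V + (sep + J)) (x : J + bag) : R :=
  match e, x with
  | inl v, inl _ => 0
  | inl v, inr k => (pick_bag v predT k)%:R
  | inr (inl w), inl _ => 0
  | inr (inl w), inr k =>
      let: (v, T) := val w in let P := fun U => U :&: (F v :\ v) == T in
      (pick_bag v P k)%:R - (pick_bag (par v) P k)%:R
  | inr (inr j), inl j' => (j' == j)%:R
  | inr (inr j), inr k => - (pick_bag (home j) (sat j) k)%:R
  end.

Definition eq_const (e : V + (sep + J)) : R :=
  match e with inl _ => 1 | inr _ => 0 end.

Definition local_system : lin_system R (J + 'I_#|{: bag}|)%type :=
  fin_system ineq_row (fun=> 0) eq_row eq_const.

Lemma sum_pick_bag (lam : V -> {set V} -> R) v P :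
    (forall v (T : {set V}), ~~ (T \subset F v) -> lam v T = 0) ->
  \sum_(k : bag) (pick_bag v P k)%:R * lam (val k).1 (val k).2 =
  \sum_T lam v T * (P T)%:R.
Proof.
move=> supp.
transitivity (\sum_(x in bag_pred) ((x.1 == v) && P x.2)%:R * lam x.1 x.2).
  by rewrite [RHS]big_sub.
transitivity (\sum_u \sum_T ((u == v) && P T)%:R * lam u T).
  rewrite pair_bigA big_mkcond /=; apply: eq_bigr => -[u T] _.
  rewrite inE /=; case: ifPn => // /supp ->; by rewrite mulr0.
rewrite (bigD1 v) //= eqxx [X in _ + X]big1 ?addr0.
  by apply: eq_bigr => T _; rewrite mulrC.
by move=> u /negPf ->; apply: big1 => T _; rewrite mul0r.
Qed.

Lemma local_systemP (z : J -> R) :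
  (exists y, solution local_system (join_point z y)) <->
  exists2 lam, local_model F par lam & forall j, z j = read_off home sat lam j.
Proof.
rewrite /local_system fin_systemP; split=> [[y [Ha Hc]]|[lam [lam0 supp tot agr] zE]].
- pose lam v T : R := oapp y 0 (insub (v, T)).
  have yE k : y k = lam (val k).1 (val k).2.
    by rewrite /lam -surjective_pairing valK.
  have supp v (T : {set V}) : ~~ (T \subset F v) -> lam v T = 0.
    by move=> nTF; rewrite /lam insubN.
  have sumE v P : \sum_k (pick_bag v P k)%:R * y k = \sum_T lam v T * (P T)%:R.
    by rewrite -(sum_pick_bag _ _ supp); apply: eq_bigr => k _; rewrite yE.
  have tot v : \sum_T lam v T = 1.
    have := Hc (inl v); rewrite big_sumType /= big1 ?add0r => [|j _]; last first.
      by rewrite mul0r.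
    by rewrite sumE => <-; apply: eq_bigr => T _; rewrite mulr1.
  exists lam; first split=> //.
  + move=> v T; rewrite /lam; case: insubP => //= k _ _.
    have := Ha k; rewrite big_sumType /= big1 ?add0r => [|j _]; last first.
      by rewrite mul0r.
    rewrite (bigD1 k) //= eqxx big1 ?addr0 => [|i /negPf ->].
      by rewrite mulN1r oppr_le0.
    by rewrite oppr0 mul0r.
  + move=> v T; have [TF|nTF] := boolP (T \subset F v :\ v); last first.
      (* No equation is imposed for such T, but both marginals are empty sums. *)
      rewrite /marginal !big1 // => U /eqP UT; case/negP: nTF;
      by rewrite -UT subsetIr.
    have := Hc (inr (inl (Sub (v, T) TF))); rewrite big_sumType /= big1 ?add0r.
      under eq_bigr do rewrite mulrBl.
      rewrite big_split sumrN /= !sumE !marginalE => /eqP.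
      by rewrite subr_eq0 => /eqP.
    by move=> j _; rewrite mul0r.
  + move=> j; have := Hc (inr (inr j)); rewrite big_sumType /= (bigD1 j) //= eqxx.
    rewrite mul1r big1 ?addr0 => [|i /negPf ->]; last by rewrite mul0r.
    under eq_bigr do rewrite mulNr.
    by rewrite sumrN sumE => /eqP; rewrite subr_eq0 => /eqP.
exists (fun k => lam (val k).1 (val k).2); split=> [k|[v|[[[v T] /= TF]|j]]];
    rewrite big_sumType /=.
- rewrite big1 ?add0r => [|j _]; last by rewrite mul0r.
  rewrite (bigD1 k) //= eqxx big1 ?addr0 => [|i /negPf ->].
    by rewrite mulN1r oppr_le0.
  by rewrite oppr0 mul0r.
- rewrite big1 ?add0r => [|j _]; last by rewrite mul0r.
  by rewrite sum_pick_bag //= -[RHS](tot v); apply: eq_bigr => T _; rewrite mulr1.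
- rewrite big1 ?add0r => [|j _]; last by rewrite mul0r.
  under eq_bigr do rewrite mulrBl.
  rewrite big_split sumrN /= !sum_pick_bag // -!marginalE agr.
  by rewrite subrr.
- rewrite (bigD1 j) //= eqxx mul1r big1 ?addr0 => [|i /negPf ->]; last first.
    by rewrite mul0r.
  under eq_bigr do rewrite mulNr.
  by rewrite sumrN sum_pick_bag // zE subrr.
Qed.

Lemma local_system_0pm1 : all_data_0pm1 local_system.
Proof.
have H0 : in_0pm1 (0 : R) by constructor 1.
have Hb (b : bool) : in_0pm1 (b%:R : R).
  by case: b; [constructor 2|constructor 1].
have Hn (b : bool) : in_0pm1 (- b%:R : R).
  by case: b; [constructor 3|rewrite oppr0; constructor 1].
split=> //= i.
- by case=> j //=; rewrite /ineq_row.
- case: (enum_val i) => [v|[w|j]] [j'|k] //=.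
  case: (val w) => v T; move: (pick_bag _ _ _) (pick_bag _ _ _) => [] [] /=;
    rewrite ?subrr ?mulr0n ?subr0 ?sub0r //; [exact: (Hn true)|exact: (Hb true)].
- by rewrite /eq_const; case: (enum_val i) => _; [apply: (Hb true)|].
Qed.

(** Bounds the number of variables as well as that of agreement equations. *)
Lemma card_pairs (B : V -> {set V}) (m : nat) : (forall v, (#|B v| <= m)%N) ->
  (#|[pred x : V * {set V} | x.2 \subset B x.1]| <= #|V| * 2 ^ m)%N.
Proof.
move=> Bm; rewrite -sum1_card.
rewrite -(pair_big_dep xpredT (fun v (T : {set V}) => T \subset B v) (fun _ _ => 1%N)) /=.
apply: (@leq_trans (\sum_(v : V) 2 ^ m)%N); last by rewrite sum_nat_const.
apply: leq_sum => v _.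
rewrite sum1_card -cardsE -/(powerset (B v)) card_powerset.
by rewrite leq_exp2l.
Qed.

Lemma local_system_size m : (0 < m)%N -> (forall v, v \in F v) ->
    (forall v, (#|F v| <= m)%N) ->
  [/\ (num_var local_system <= #|J| + #|V| * 2 ^ m)%N,
      (num_ineq local_system <= #|V| * 2 ^ m)%N
    & (num_eq local_system <= #|J| + #|V| * (1 + 2 ^ m.-1))%N].
Proof.
move=> m0 vF Fm.
have Hbag : (#|{: bag}| <= #|V| * 2 ^ m)%N by rewrite card_sig; apply: (card_pairs Fm).
have Hsep : (#|{: sep}| <= #|V| * 2 ^ m.-1)%N.
  rewrite card_sig; apply: (@card_pairs (fun v => F v :\ v)) => v.
  by have := Fm v; rewrite (cardsD1 v (F v)) vF add1n; case: m m0 {Fm Hbag}.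
split; first by rewrite /num_var card_sum card_ord leq_add2l.
  exact: Hbag.
rewrite /= !card_sum mulnDr muln1 [leqRHS]addnCA leq_add2l.
by rewrite addnC leq_add2l.
Qed.

End LocalSystem.

(** * Signed edges *)

Section SignedHypergraphs.
Variable V : finType.
Implicit Types (s : signed_edge V) (U B : {set V}).

Definition satisfies s U : bool := [forall u, tagged s u == (val u \in U)].

Lemma edge_prod_satisfies (R : realType) s U :
  edge_prod s (fun v => (v \in U)%:R : R) = (satisfies s U)%:R.
Proof.
have factor u : (if tagged s u then (val u \in U)%:R else 1 - (val u \in U)%:R)
    = (tagged s u == (val u \in U))%:R :> R.
  by case: (tagged s u); case: (val u \in U); rewrite ?subrr ?subr0.
rewrite /edge_prod /satisfies; under eq_bigr do rewrite factor.
case: forallP => [all_u|/forallP]; first by rewrite big1 // => u _; rewrite all_u.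
by rewrite negb_forall => /existsP[u /negPf nu]; rewrite (bigD1 u) //= nu mul0r.
Qed.

Lemma satisfies_local s U B : tag s \subset B ->
  satisfies s (U :&: B) = satisfies s U.
Proof.
move=> sB; apply: eq_forallb => u.
by rewrite inE (subsetP sB _ (valP u)) andbT.
Qed.

(** Trades the dependent pair (e, eta) for a plain function on all nodes, so
    that signed edges can be counted node by node. *)
Definition edge_label s : {ffun V -> option bool} :=
  [ffun v => omap (tagged s) (insub v)].

Lemma edge_label_inj : injective edge_label.
Proof.
have label_in s (u : {v | v \in tag s}) : edge_label s (val u) = Some (tagged s u).
  by rewrite ffunE valK.
have mem_label s v : (v \in tag s) = (edge_label s v != None).
  by rewrite ffunE; case: insubP => [u -> _|/negPf ->].
move=> s s' eqs; have eqtag : tag s = tag s'.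
  by apply/setP=> v; rewrite !mem_label eqs.
case: s s' eqtag eqs => [e eta] [e' eta'] /= eqe; case: e' / eqe eta' => eta' eqs.
congr existT; apply/ffunP=> u; apply: Some_inj.
pose sign_of (f : {set V}) := {ffun {v | v \in f} -> bool} : finType.
by rewrite -(label_in (Tagged sign_of eta)) eqs label_in.
Qed.

(** Three labels are possible at each node of B, but only the two signs at v. *)
Lemma card_signed_edges_at v B : v \in B ->
  (#|[set s : signed_edge V | (v \in tag s) && (tag s \subset B)]|
     <= 2 * 3 ^ (#|B|.-1))%N.
Proof.
move=> vB; rewrite -(card_imset _ edge_label_inj).
pose choices u := if u == v then predC1 (None : option bool) else predT.
apply: (@leq_trans #|pfamily None (mem B) choices|).
  apply/subset_leq_card/subsetP=> f /imsetP[s]; rewrite inE => /andP[vs sB] ->.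
  apply/pfamilyP; split=> [|u uB].
    apply/subsetP=> u; rewrite inE ffunE; apply: contraR => uNB.
    by rewrite insubN //; apply: contra uNB; apply: (subsetP sB).
  rewrite /choices; case: eqP => [->|//].
  by rewrite !inE ffunE insubT.
rewrite card_pfamily foldrE big_map big_enum (bigD1 v) //= /choices eqxx.
rewrite cardC1 card_option card_bool leq_mul2l /=.
rewrite (eq_bigr (fun=> 3)) => [|u /andP[_ /negPf ->]]; last first.
  by rewrite card_option card_bool.
rewrite prod_nat_const leq_exp2l // (cardD1 v B) vB add1n /=.
by rewrite subset_leq_card //; apply/subsetP=> u; rewrite !inE andbC.
Qed.

Lemma card_sedges (H : signed_hypergraph V) (F : V -> {set V}) m :
    (forall v, v \in F v) -> (forall v, (#|F v| <= m)%N) ->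
    (forall s, s \in sedges H ->
       exists v, v \in tag s /\ tag s \subset F v) ->
  (#|sedges H| <= #|V| * (2 * 3 ^ m.-1))%N.
Proof.
move=> vF Fm home.
pose at_ v := [set s : signed_edge V | (v \in tag s) && (tag s \subset F v)].
have sub : sedges H \subset \bigcup_v at_ v.
  apply/subsetP=> s /home[v [vs sF]]; apply/bigcupP; exists v => //.
  by rewrite inE vs.
apply: leq_trans (subset_leq_card sub) _.
apply: (@leq_trans (\sum_(v : V) 2 * 3 ^ m.-1)%N); last by rewrite sum_nat_const.
elim/big_ind2: _ => [|n1 A1 n2 A2 le1 le2|v _]; first by rewrite cards0.
  exact: leq_trans (leq_card_setU _ _) (leq_add le1 le2).
apply: leq_trans (card_signed_edges_at (vF v)) _.
by rewrite leq_mul2l leq_exp2l //= -!subn1 leq_sub2r.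
Qed.

End SignedHypergraphs.

(** * Numerical bounds *)

(** The factor of n in [size_bound], as a natural number. *)
Definition node_bound (r : nat) : nat :=
  2 * 3 ^ r.-1 + 2 * r.-1 * (2 ^ r + 1).

Lemma size_boundE (R : realType) r n : (0 < r)%N ->
  size_bound R r n = (node_bound r * n)%:R.
Proof.
case: r => // r _; rewrite /size_bound /node_bound /=.
rewrite natrM natrD !natrM natrD !natrX exprS -natr1.
by field.
Qed.

(** The local variables and their inequalities cost 2 * 2^r per node; since
    r >= 2 the second term of the bound is at least 2 * (2^r + 1), which also
    pays for the node variables. *)
Lemma vars_and_inequalities_le r n (E : nat) : (2 <= r)%N ->
  (E <= n * (2 * 3 ^ r.-1))%N ->
  (n + E + n * 2 ^ r + n * 2 ^ r <= node_bound r * n)%N.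
Proof.
case: r => [|[|m]] // _ /= leE; rewrite /node_bound /=.
have := leq_mul (leqnn n) (leq_pmull (2 ^ m.+2 + 1) (ltn0Sn m)).
move: leE; move: (3 ^ m.+1)%N (2 ^ m.+2)%N => x y; nia.
Qed.

Lemma constraints_le r n (E : nat) : (2 <= r)%N ->
  (E <= n * (2 * 3 ^ r.-1))%N ->
  (n * 2 ^ r + (n + E + n * (1 + 2 ^ r.-1)) <= node_bound r * n)%N.
Proof.
move=> r2 leE; apply: leq_trans (vars_and_inequalities_le r2 leE).
case: r r2 {leE} => // m m1; rewrite expnS /=.
have : (1 <= 2 ^ m)%N by rewrite expn_gt0.
by move: (2 ^ m)%N => y; nia.
Qed.

Lemma node_bound_le r : (0 < r)%N -> (node_bound r <= 6 * 4 ^ r)%N.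
Proof.
case: r => // m _; rewrite /node_bound /= expnS (expnS 4).
have x1 : (3 ^ m <= 4 ^ m)%N by elim: (m) => // k; rewrite !expnS; lia.
have x2 : (m * 2 ^ m <= 4 ^ m)%N.
  by rewrite (expnMn 2 2) leq_mul2r ltnW ?orbT // ltn_expl.
have x3 : (m <= 4 ^ m)%N by rewrite ltnW // ltn_expl.
nia.
Qed.

(** As 2 <= e, 4^r <= e^(2r) <= e^(2C ln P), and 2C is rounded up to a natural
    number, which is sound because ln P > 0. *)
Lemma exp_le_poly (R : realType) (C P : R) (r : nat) : 0 < C -> (0 < r)%N ->
  r%:R <= C * ln P -> 4 ^+ r <= P ^+ Num.bound (2 * C).
Proof.
move=> C0 r0 leP.
have lnP : 0 < ln P.
  by rewrite -(pmulr_rgt0 _ C0); apply: lt_le_trans leP; rewrite ltr0n.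
have P0 : 0 < P by rewrite ltNge; apply: contraL lnP => /ln0 ->; rewrite ltxx.
have e2 : 2 <= expR 1 :> R by have := expR_ge1Dx (1 : R).
apply: (@le_trans _ _ (expR (r%:R * 2))).
  rewrite expRM_natl; apply: lerXn2r; rewrite ?nnegrE ?expR_ge0 //.
  have -> : 2 = 1 + 1 :> R by [].
  by rewrite expRD; have := e2; nra.
apply: (@le_trans _ _ (expR ((Num.bound (2 * C))%:R * ln P))).
  rewrite ler_expR; apply: (@le_trans _ _ (2 * C * ln P)); first by nra.
  rewrite ler_wpM2r ?ltW // archi_boundP //.
  by rewrite mulr_ge0 // ltW.
by rewrite expRM_natl lnK ?posrE.
Qed.

(** * The pseudo-Boolean polytope *)

Section PseudoBoolean.
Variables (R : realType) (V : finType) (H : signed_hypergraph V).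

Definition zvar_sat (j : zvar H) (U : {set V}) : bool :=
  match j with inl v => v \in U | inr s => satisfies (val s) U end.

(** The edge coordinates of a point are determined by its node coordinates, so
    the points correspond to the subsets of V. *)
Lemma pB_set_vertices :
  @pB_set R V H = (fun z => exists U, z = vertex R zvar_sat U).
Proof.
apply/funext=> z; apply/propext; split=> [[z01 zS]|[U ->]].
  exists [set v | z (inl v) == 1].
  have zV v : z (inl v) = (v \in [set v | z (inl v) == 1])%:R.
    by rewrite inE; case: (z01 (inl v)) => ->; rewrite ?eqxx // eq_sym oner_eq0.
  apply/ffunP=> -[v|s]; rewrite ffunE; first exact: zV.
  by rewrite zS -edge_prod_satisfies; congr edge_prod; apply/funext.
split=> [j|s]; first by rewrite ffunE; case: zvar_sat; [right|left].
rewrite ffunE -edge_prod_satisfies; congr edge_prod.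
by apply/funext=> v; rewrite ffunE.
Qed.

Lemma pB_extended_formulation r :
    has_rank H r -> alpha_acyclic (underlying_hypergraph H) ->
  exists (k : nat) (L : lin_system R (zvar H + 'I_k)%type),
    [/\ extended_formulation L,
        (num_var L + num_ineq L <= node_bound r * #|V|)%N,
        (num_constr L <= node_bound r * #|V|)%N
      & all_data_0pm1 L].
Proof.
move=> [[s0 s0H s0r] rk] [s [us sV elim_s]].
have r2 : (2 <= r)%N by rewrite -s0r; apply: sedges_card s0H.
have sT v : v \in s by rewrite sV inE.
have edgeP e : e \in hedges (underlying_hypergraph H) ->
    exists2 t, t \in sedges H & e = tag t.
  by case/imsetP=> t tH ->; exists t.
have [||e /edgeP[t tH ->]|F [par [perf Fr cover]]] :=
    @perfect_elimination_ex V r _ s _ us _ _ elim_s.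
- exact: ltnW.
- by move=> e _; apply/subsetP=> v _; rewrite inE.
- exact: rk.
have Fm v : (#|F v| <= r)%N by apply: Fr.
have vF v : v \in F v by apply: perfect_elimination_mem perf _.
have Fpar v : F v :\ v \subset F (par v).
  by apply: perfect_elimination_par perf _.
have coverS t : t \in sedges H -> exists v, v \in tag t /\ tag t \subset F v.
  move=> tH; have [||v [_ vt tF]] := cover (tag t); last by exists v.
    exact: imset_f.
  by rewrite -card_gt0 ltnW // (sedges_card tH).
have homeP (j : zvar H) : exists v, forall U, zvar_sat j (U :&: F v) = zvar_sat j U.
  case: j => [v|[t tH]] /=.
    by exists v => U; rewrite inE vF andbT.
  have [v [_ tF]] := coverS _ tH; exists v => U.
  exact: satisfies_local.
pose home j := sval (cid (homeP j)).
have sat_home j U : zvar_sat j (U :&: F (home j)) = zvar_sat j U.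
  exact: svalP (cid (homeP j)) U.
have [nvar nineq neq] := @local_system_size R V F par _ home zvar_sat r (ltnW r2) vF Fm.
have nS := card_sedges vF Fm coverS.
have nJ : #|zvar H| = (#|V| + #|sedges H|)%N by rewrite card_sum card_sig.
exists _, (local_system R F par home zvar_sat); split.
- move=> z; rewrite /pB_polytope pB_set_vertices local_systemP.
  exact: hull_local_model us sT perf Fpar.
- apply: leq_trans (vars_and_inequalities_le r2 nS).
  by rewrite -nJ leq_add.
- apply: leq_trans (constraints_le r2 nS).
  by rewrite -nJ leq_add.
- exact: local_system_0pm1.
Qed.

End PseudoBoolean.

Theorem theorem6 (R : realType) :
  (forall (V : finType) (H : signed_hypergraph V) (r : nat),
     has_rank H r ->
     alpha_acyclic (underlying_hypergraph H) ->
     exists (k : nat) (L : lin_system R (zvar H + 'I_k)%type),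
       [/\ extended_formulation L,
           (num_var L + num_ineq L)%:R <= size_bound R r #|V|,
           (num_constr L)%:R <= size_bound R r #|V|
         & all_data_0pm1 L])
  /\
  (forall (I : Type) (V : I -> finType) (H : forall i, signed_hypergraph (V i))
      (r : I -> nat) (C : R) (p : {poly {poly R}}),
     (forall i, has_rank (H i) (r i)) ->
     (forall i, alpha_acyclic (underlying_hypergraph (H i))) ->
     0 < C ->
     (forall i, (r i)%:R <= C * ln p.[#|V i|%:R, #|sedges (H i)|%:R]) ->
     exists q : {poly {poly R}}, forall i,
       exists (k : nat) (L : lin_system R (zvar (H i) + 'I_k)%type),
         [/\ extended_formulation L,
             (num_var L + num_constr L)%:R
               <= q.[#|V i|%:R, #|sedges (H i)|%:R]
           & all_data_0pm1 L]).
Proof.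
have rank_gt0 (V : finType) (H : signed_hypergraph V) r : has_rank H r -> (0 < r)%N.
  by case=> [[s sH <-] _]; rewrite ltnW // (sedges_card sH).
split=> [V H r rkH acH|I V H r C p rkH acH C0 le_r].
  have [k [L [ext nvar nconstr data]]] := pB_extended_formulation R rkH acH.
  by exists k, L; rewrite size_boundE ?(rank_gt0 _ _ _ rkH) // !ler_nat.
(* Twice the bound 6 * 4 ^ r * n, for variables and for constraints. *)
exists (12%:P%:P * p ^+ Num.bound (2 * C) * 'X) => i.
have [k [L [ext nvar nconstr data]]] := pB_extended_formulation R (rkH i) (acH i).
exists k, L; split=> //.
have r0 := rank_gt0 _ _ _ (rkH i).
have le_num : (num_var L + num_constr L <= 12 * 4 ^ r i * #|V i|)%N.
  have := leq_mul (node_bound_le r0) (leqnn #|V i|).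
  by move: nvar nconstr; nia.
apply: (@le_trans _ _ (12 * 4 ^+ r i * #|V i|%:R)).
  by rewrite -natrX -!natrM ler_nat.
rewrite !(hornerM, horner_exp, hornerC, hornerX).
rewrite ler_wpM2r // ler_wpM2l //.
exact: exp_le_poly C0 r0 (le_r i).
Qed.
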